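(* Let $G$ be a graph on $[n]$ and let $d\ge 2$. Consider all triples consisting of a minor $H$ of $G$ (together with the way it is obtained from $G$), a graph homomorphism $\phi:H\to X_d$ such that the restriction $\widetilde{f_d}$ of the distinguished generator $f_d$ to the image subgraph $R=\phi(H)$ is a minimal generator of $I_R$, and a choice of a constant value $0$ or $1$ for each vertex of $G$ deleted in forming $H$. For each such triple let $\phi^\star\widetilde{f_d}$ be the pullback binomial. Then each $\phi^\star\widetilde{f_d}$ is a binomial of degree $d$ in $I_G$, and, up to the action of $(\mathbb{Z}/2)^n$, the binomials $\phi^\star \widetilde{f_d}$ obtained in this way include all minimal generators of $I_G$ of degree $d$: every binomial of degree $d$ in $I_G$ that is a minimal generator of $I_G$ lies in the $(\mathbb{Z}/2)^n$-orbit of some $\phi^\star\widetilde{f_d}$ obtained in this way.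
   Context: Graphs are finite and simple. For a graph $G$ with vertex set $[n]$, edge set $E(G)$ and set of isolated vertices $Iso(G)$, $I_G$ is the kernel of the $\mathbb{C}$-algebra homomorphism $$\phi_G:\mathbb{C}[p_{i_1\cdots i_n}\mid i_j\in\{0,1\}]\to \mathbb{C}[t^{(j,k)}_{a,b},\,t^{(l)}_{a}\mid \{j,k\}\in E(G),\ l\in Iso(G),\ a,b\in\{0,1\}],$$ $$p_{i_1\cdots i_n}\mapsto \prod_{\{j,k\}\in E(G)}t^{(j,k)}_{i_j,i_k}\prod_{l\in Iso(G)}t^{(l)}_{i_l};$$ it is a homogeneous toric ideal. The same definition applies to a graph with any finite vertex set $V$, the variables being indexed by $\{0,1\}^V$. A homogeneous binomial $f\in I_G$ of degree $d$ is a minimal generator of $I_G$ if it is not in the ideal generated by the elements of $I_G$ of degree less than $d$. Tableau notation: a binomial $\prod_{j=1}^d p_{I_j}-\prod_{j=1}^d p_{J_j}$ is written as a difference of two $0$-$1$ matrices, with rows $I_1,\dots,I_d$ and $J_1,\dots,J_d$ respectively and columns indexed by the vertices of the graph. The group $(\mathbb{Z}/2)^n$ acts on $\mathbb{C}[p_{i_1\cdots i_n}]$: $(c_1,\dots,c_n)$ sends $p_{i_1\cdots i_n}$ to $p_{j_1\cdots j_n}$ with $j_r=i_r+c_r$ in $\mathbb{Z}/2$. A minor of $G$ is a graph $H$ obtained from $G$ by a sequence of edge contractions and vertex deletions (no edge deletions; multiple edges are merged). Thus each vertex of $G$ is either deleted or has an image vertex in $H$. A graph homomorphism $H\to X$ is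 a map on vertices sending adjacent vertices to adjacent vertices; its image subgraph has as vertices the images of the vertices of $H$ and as edges the images of the edges of $H$. The fundamental graph $X_d$ has as vertices all pairs $(S,T)$ of nonempty subsets of $\{1,\dots,d\}$ with $|S|=|T|\le d/2$ and such that $1\in S$ if $|S|=d/2$. Two distinct vertices $(S_1,T_1)$ and $(S_2,T_2)$ are joined by an edge if and only if $|S_1\cap S_2|=|T_1\cap T_2|$. The distinguished generator $f_d\in I_{X_d}$ is the binomial $\prod_{j=1}^d p_{I_j}-\prod_{j=1}^d p_{J_j}$ where the entry of $I_j$ in the column of the vertex $(S,T)$ is $1$ if $j\in S$ and $0$ otherwise, and the entry of $J_j$ in that column is $1$ if $j\in T$ and $0$ otherwise. For a subgraph $R$ of $X_d$, the restriction $\widetilde{f_d}$ is the binomial in $I_R$ obtained by keeping only the columns indexed by vertices of $R$. Given a minor $H$ of $G$, a homomorphism $\phi:H\to X_d$, and a constant $0$ or $1$ for each deleted vertex, the pullback $\phi^\star\widetilde{f_d}$ is the binomial with columns indexed by the vertices of $G$ in which a vertex $v$ whose image in $H$ is $h$ receives, in both matrices, the column of $\widetilde{f_d}$ indexed by $\phi(h)$, and each deleted vertex receives, in both matrices, the column all of whose entries equal its chosen constant. *)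

(* Defs.v *)
From mathcomp Require Import all_boot all_order all_algebra.
From mathcomp Require Export mpoly complex reals.

Set Implicit Arguments.
Unset Strict Implicit.
Unset Printing Implicit Defensive.

Import GRing.Theory.
Local Open Scope ring_scope.

Record sgraph (V : finType) := SGraph {
  adj : rel V;
  adj_sym : ssrbool.symmetric adj;
  adj_irr : irreflexive adj }.

Lemma adj_neq (V : finType) (G : sgraph V) (a b : V) : adj G a b -> a != b.
Proof. by apply: contraTneq => ->; rewrite adj_irr. Qed.

(* An edge {j, k} is represented by its orientation that is increasing for the
   enumeration order of V; on 'I_n this is the usual order j < k. *)
Definition edge (V : finType) (G : sgraph V) : finType :=
  {e : V * V | (enum_rank e.1 < enum_rank e.2)%N && adj G e.1 e.2}.

Definition iso (V : finType) (G : sgraph V) : finType :=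
  {l : V | [forall k, ~~ adj G l k]}.

(* 0-1 words are boolean functions, with true for 1. *)
Notation word V := {ffun V -> bool}.

(* C[p_u | u in {0,1}^V] and C[t^(j,k)_{a,b}, t^(l)_a]; multinomials indexes
   variables by ordinals, so indices go through enum_rank / enum_val. *)
Notation pring K V := {mpoly K[#|{ffun V -> bool}|]}.
Definition tvar (V : finType) (G : sgraph V) : finType :=
  (edge G * (bool * bool) + iso G * bool)%type.
Notation tring K G := {mpoly K[#|tvar G|]}.

Section ToricIdeal.
Variable K : comNzRingType.

Definition pvar (V : finType) (u : word V) : pring K V := 'X_(enum_rank u).

Definition tedge (V : finType) (G : sgraph V) (e : edge G) (a b : bool) :
  tring K G := 'X_(enum_rank (inl (e, (a, b)) : tvar G)).

Definition tiso (V : finType) (G : sgraph V) (l : iso G) (a : bool) :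
  tring K G := 'X_(enum_rank (inr (l, a) : tvar G)).

Definition phi_word (V : finType) (G : sgraph V) (u : word V) : tring K G :=
  (\prod_(e : edge G) tedge e (u (val e).1) (u (val e).2)) *
  \prod_(l : iso G) tiso l (u (val l)).

Definition phi_hom (V : finType) (G : sgraph V) : pring K V -> tring K G :=
  mmap (@mpolyC _ K) (fun i => phi_word G (enum_val i)).

Definition toric_ideal (V : finType) (G : sgraph V) (f : pring K V) : Prop :=
  phi_hom G f = 0.

Definition ideal_generated (A : comNzRingType) (S : A -> Prop) (f : A) : Prop :=
  exists s : seq (A * A),
    (forall x, x \in s -> S x.2) /\ f = \sum_(x <- s) x.1 * x.2.

(* A table of d rows with columns indexed by V. *)
Definition table (d : nat) (V : finType) := 'I_d -> word V.

Definition binom_of (d : nat) (V : finType) (I J : table d V) : pring K V :=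
  \prod_(j < d) pvar (I j) - \prod_(j < d) pvar (J j).

(* The two monomials have degree d, so f is homogeneous of degree d. *)
Definition is_binomial (d : nat) (V : finType) (f : pring K V) : Prop :=
  f != 0 /\ exists I J : table d V, f = binom_of I J.

(* msize is the degree plus one, hence the elements of degree less than d are
   those with msize at most d. *)
Definition is_min_generator (V : finType) (G : sgraph V) (d : nat)
    (f : pring K V) : Prop :=
  [/\ is_binomial d f, toric_ideal G f
    & ~ ideal_generated (fun g => toric_ideal G g /\ (msize g <= d)%N) f].

(* The action of (Z/2)^V, with Z/2 = (bool, addb). *)
Definition flip_word (V : finType) (c u : word V) : word V :=
  [ffun v => u v (+) c v].
Definition flip (V : finType) (c : word V) : pring K V -> pring K V :=
  mmap (@mpolyC _ K) (fun i => pvar (flip_word c (enum_val i))).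

End ToricIdeal.

Section Minors.
Variables (V : finType) (G : sgraph V).

Section Delete.
Variable w : V.
Let delete_adj : rel {x : V | x != w} := fun x y => adj G (val x) (val y).
Fact delete_sym : ssrbool.symmetric delete_adj.
Proof. by move=> x y; apply: adj_sym. Qed.
Fact delete_irr : irreflexive delete_adj.
Proof. by move=> x; apply: adj_irr. Qed.
Definition delete := SGraph delete_sym delete_irr.
Definition delete_vertex (x : V) : option {x : V | x != w} := insub x.
End Delete.

(* Contraction of the edge {a, b}: the merged vertex keeps the name a. *)
Section Contract.
Variables (a b : V) (ab : adj G a b).
Definition contract_vertex (x : V) : {x : V | x != b} :=
  insubd (exist (fun x => x != b) a (adj_neq ab)) x.
Let contract_adj : rel {x : V | x != b} := fun x y =>
  (x != y) && [exists u, exists v,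
    [&& adj G u v, contract_vertex u == x & contract_vertex v == y]].
Fact contract_sym : ssrbool.symmetric contract_adj.
Proof.
move=> x y; rewrite /contract_adj eq_sym; congr (_ && _).
by apply/existsP/existsP=> -[u /existsP[v /and3P[uv ux vy]]];
  exists v; apply/existsP; exists u; rewrite adj_sym uv ux vy.
Qed.
Fact contract_irr : irreflexive contract_adj.
Proof. by move=> x; rewrite /contract_adj eqxx. Qed.
Definition contract := SGraph contract_sym contract_irr.
End Contract.

End Minors.

(* [minor G H f]: H is reached from G by vertex deletions and edge
   contractions, f v being the image of v in H, or None if v was deleted (or
   merged into a vertex that was later deleted). *)
Inductive minor (V : finType) (G : sgraph V) :
    forall W : finType, sgraph W -> (V -> option W) -> Prop :=
| MinorRefl : minor G G Some
| MinorDelete (W : finType) (H : sgraph W) (f : V -> option W) (w : W) :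
    minor G H f ->
    minor G (delete H w) (fun v => obind (delete_vertex w) (f v))
| MinorContract (W : finType) (H : sgraph W) (f : V -> option W) (a b : W)
    (ab : adj H a b) :
    minor G H f ->
    minor G (contract ab) (fun v => omap (contract_vertex ab) (f v)).

Record ghom (W X : finType) (H : sgraph W) (Y : sgraph X) := GHom {
  ghom_fun :> W -> X;
  ghom_adj : forall x y, adj H x y -> adj Y (ghom_fun x) (ghom_fun y) }.

Section Image.
Variables (W X : finType) (H : sgraph W) (Y : sgraph X) (phi : ghom H Y).

Definition im_vertex : finType := {x : X | x \in codom phi}.

Definition to_im (h : W) : im_vertex :=
  exist (fun x => x \in codom phi) (phi h) (codom_f phi h).

Let im_adj : rel im_vertex := fun x y =>
  [exists a, exists b, [&& adj H a b, to_im a == x & to_im b == y]].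
Fact im_sym : ssrbool.symmetric im_adj.
Proof.
move=> x y; rewrite /im_adj.
apply/existsP/existsP=> -[u /existsP[v /and3P[uv ux vy]]];
  by exists v; apply/existsP; exists u; rewrite adj_sym uv ux vy.
Qed.
Fact im_irr : irreflexive im_adj.
Proof.
move=> x; apply/negbTE/negP=> /existsP[a /existsP[b /and3P[ab /eqP ax /eqP bx]]].
have /(congr1 val)/= e : to_im a = to_im b by rewrite ax bx.
by have := ghom_adj phi ab; rewrite e adj_irr.
Qed.
Definition im_graph := SGraph im_sym im_irr.
End Image.

Section Fundamental.
Variable d : nat.

(* The set {1, ..., d} is 'I_d, so the element 1 is the ordinal of value 0. *)
Definition fund_vertex_pred (ST : {set 'I_d} * {set 'I_d}) : bool :=
  [&& ST.1 != set0, ST.2 != set0, #|ST.1| == #|ST.2|, (2 * #|ST.1| <= d)%N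
    & (2 * #|ST.1| == d)%N ==> [exists j in ST.1, val j == 0%N]].

Definition fund_vertex : finType :=
  {ST : {set 'I_d} * {set 'I_d} | fund_vertex_pred ST}.

Let fund_adj : rel fund_vertex := fun x y =>
  (x != y) &&
  (#|(val x).1 :&: (val y).1| == #|(val x).2 :&: (val y).2|).
Fact fund_sym : ssrbool.symmetric fund_adj.
Proof.
by move=> x y; rewrite /fund_adj eq_sym (setIC (val x).1) (setIC (val x).2).
Qed.
Fact fund_irr : irreflexive fund_adj.
Proof. by move=> x; rewrite /fund_adj eqxx. Qed.
Definition fund_graph := SGraph fund_sym fund_irr.

(* The tables I and J of the distinguished generator f_d. *)
Definition fund_I : table d fund_vertex :=
  fun j => [ffun x : fund_vertex => j \in (val x).1].
Definition fund_J : table d fund_vertex :=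
  fun j => [ffun x : fund_vertex => j \in (val x).2].

Definition fund_gen (K : comNzRingType) : pring K fund_vertex :=
  binom_of K fund_I fund_J.

End Fundamental.

Definition restrict_table (d : nat) (X : finType) (P : pred X)
    (I : table d X) : table d {x : X | P x} :=
  fun j => [ffun x : {x : X | P x} => I j (val x)].

Section Pullback.
Variables (d : nat) (V W : finType) (H : sgraph W).
Variable phi : ghom H (fund_graph d).

Definition restricted_I : table d (im_vertex phi) :=
  restrict_table (fun x => x \in codom phi) (@fund_I d).
Definition restricted_J : table d (im_vertex phi) :=
  restrict_table (fun x => x \in codom phi) (@fund_J d).

Definition restricted_gen (K : comNzRingType) : pring K (im_vertex phi) :=
  binom_of K restricted_I restricted_J.

(* Only the values of c at deleted vertices are used. *)
Definition pullback_table (f : V -> option W) (c : V -> bool)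
    (I : table d (im_vertex phi)) : table d V :=
  fun j => [ffun v => if f v is Some h then I j (to_im phi h) else c v].

Definition pullback (K : comNzRingType) (f : V -> option W) (c : V -> bool) :
    pring K V :=
  binom_of K (pullback_table f c restricted_I)
             (pullback_table f c restricted_J).

End Pullback.

(* Main.v *)
Require Import Defs.
From mathcomp Require Import all_boot all_order all_algebra.
From mathcomp Require Import mpoly complex reals.
From mathcomp Require Import zify.

Set Implicit Arguments.
Unset Strict Implicit.
Unset Printing Implicit Defensive.

Import GRing.Theory.
Local Open Scope ring_scope.

(** The map phi_G sends monomials to monomials, so whether a polynomial lies in
    I_G depends only on how phi_G groups the monomials: the coefficients must
    sum to zero over every group.  Two monomials are in the same group when, as
    multisets of 0-1 words, they have the same number of words with any given
    values at the two ends of an edge or at an isolated vertex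
    ([same_marginals]).  Equality at the edges forces equality at every vertex.

    For the converse half, take a minimal generator g of degree d, written as
    two tables.  A column v gives a pair (S, T) of subsets of {1, ..., d}, the
    positions of the ones in the two tables, and |S| = |T|.  Complementing
    columns, which is the action of (Z/2)^n, makes each pair either empty or a
    vertex of X_d ([normalizing_flip]).  The pairs of two adjacent columns are
    equal or adjacent in X_d, because the counts of rows (1, 1) agree.
    Deleting the columns with empty pair and contracting the edges between
    columns with equal pairs yields a minor with a homomorphism to X_d
    ([minor_of_labels]), and g is a flip of the pullback of f_d restricted to
    the image R ([toric_binom_pullback]).

    The restricted binomial is itself a minimal generator since pulling back is
    a ring homomorphism that maps all of I_R into I_G ([toric_pull]) without
    raising degrees: an expression of the restriction through elements of I_R
    of lower degree would be carried to such an expression of g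
    ([restricted_minimal]).  The same fact puts every pullback in I_G, and a
    pullback is nonzero because each vertex of R comes from a vertex of G, so
    that pulling back has a left inverse on tables ([pullback_in_ideal]). *)

(** * Kernels of monomial maps *)

Section MonomialMaps.
Variable K : comNzRingType.

(** The exponent of the image of the monomial with exponent [m] under the map
    that sends the i-th variable to the monomial with exponent [a i]. *)
Definition expo n k (a : 'I_n -> 'X_{1..k}) (m : 'X_{1..n}) : 'X_{1..k} :=
  [multinom (\sum_i m i * a i j)%N | j < k].

Lemma mmap_monomial n k (h : 'I_n -> {mpoly K[k]}) a m :
  (forall i, h i = 'X_[a i]) -> mmap (@mpolyC _ K) h 'X_[m] = 'X_[expo a m].
Proof.
move=> ha; rewrite mmapX /mmap1.
have -> : expo a m = (\sum_i (a i *+ m i)%MM)%MM.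
  apply/mnmP=> j; rewrite mnmE mnm_sumE; apply: eq_bigr => i _.
  by rewrite mulmnE mulnC.
rewrite (big_morph _ (@mpolyXD k K) (@mpolyX0 k K)).
by apply: eq_bigr => i _; rewrite ha mpolyXn.
Qed.

Lemma mmap_sum n k (h : 'I_n -> {mpoly K[k]}) a (f : {mpoly K[n]}) :
  (forall i, h i = 'X_[a i]) ->
  mmap (@mpolyC _ K) h f = \sum_(m <- msupp f) f@_m *: 'X_[expo a m].
Proof.
move=> ha; rewrite /mmap; apply: eq_bigr => m _.
by rewrite mul_mpolyC -(mmap_monomial _ ha) mmapX.
Qed.

(** Each fiber of [q] is a disjoint union of fibers of [p]; the induction
    removes these one at a time. *)
Lemma sum_fiber0 (T : eqType) (A B : eqType) (p : T -> A) (q : T -> B)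
    (c : T -> K) (s : seq T) :
  (forall x y, p x = p y -> q x = q y) ->
  (forall a, \sum_(x <- s | p x == a) c x = 0) ->
  forall b, \sum_(x <- s | q x == b) c x = 0.
Proof.
move=> pq; have [N] := ubnP (size s); elim: N s => // N IH [|x0 s] sN s0 b.
  by rewrite big_nil.
rewrite (bigID (fun x => p x == p x0)) /= -[RHS]addr0; congr (_ + _).
  have [<-|nb] := eqVneq (q x0) b.
    rewrite -[RHS](s0 (p x0)); apply: eq_bigl => x.
    by rewrite andb_idl // => /eqP /pq ->.
  by apply: big1 => x /andP[/eqP qx /eqP /pq qx0]; rewrite -qx0 qx eqxx in nb.
set s' := [seq x <- x0 :: s | p x != p x0].
have -> : \sum_(x <- x0 :: s | (q x == b) && (p x != p x0)) c x =
          \sum_(x <- s' | q x == b) c x.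
  by rewrite big_filter_cond; apply: eq_bigl => x; rewrite andbC.
apply: IH => [|a].
  rewrite /s' /= eqxx /= size_filter.
  by apply: leq_ltn_trans (count_size _ _) _; rewrite /= in sN.
rewrite big_filter_cond; have [->|na] := eqVneq a (p x0).
  by apply: big1 => x /andP[/negP].
rewrite -[RHS](s0 a); apply: eq_bigl => x.
by rewrite andb_idl // => /eqP ->.
Qed.

(** A polynomial is killed by a monomial map exactly when its coefficients sum
    to zero over the monomials with a common image, so a coarser grouping of
    the monomials gives a larger kernel.  Containments between toric ideals
    are thereby reduced to statements about exponents. *)
Lemma monomial_kernel_sub n k l (h : 'I_n -> {mpoly K[k]})
    (h' : 'I_n -> {mpoly K[l]}) a b (f : {mpoly K[n]}) :
  (forall i, h i = 'X_[a i]) -> (forall i, h' i = 'X_[b i]) ->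
  (forall m m', expo a m = expo a m' -> expo b m = expo b m') ->
  mmap (@mpolyC _ K) h f = 0 -> mmap (@mpolyC _ K) h' f = 0.
Proof.
move=> ha hb ab; rewrite (mmap_sum _ ha) (mmap_sum _ hb) => f0.
have coef j (a0 : 'I_n -> 'X_{1..j}) mu :
    (\sum_(m <- msupp f) f@_m *: 'X_[expo a0 m])@_mu =
    \sum_(m <- msupp f | expo a0 m == mu) f@_m.
  rewrite raddf_sum [RHS]big_mkcond; apply: eq_bigr => m _ /=.
  by rewrite mcoeffZ mcoeffX; case: eqP; rewrite ?mulr1 ?mulr0.
apply/mpolyP=> mu; rewrite mcoeff0 coef.
by apply: (sum_fiber0 ab) => nu; rewrite -coef f0 mcoeff0.
Qed.

Lemma mmap_comp_monomial n k l (h : 'I_n -> {mpoly K[k]})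
    (h' : 'I_k -> {mpoly K[l]}) (f : {mpoly K[n]}) :
  mmap (@mpolyC _ K) h' (mmap (@mpolyC _ K) h f) =
  mmap (@mpolyC _ K) (fun i => mmap (@mpolyC _ K) h' (h i)) f.
Proof.
rewrite {2}/mmap [RHS]/mmap raddf_sum; apply: eq_bigr => m _ /=.
rewrite rmorphM /= mmapC; congr (_ * _); rewrite /mmap1 rmorph_prod.
by apply: eq_bigr => i _; rewrite rmorphXn.
Qed.

Lemma msize_mmap_var n k (h : 'I_n -> {mpoly K[k]}) (r : 'I_n -> 'I_k)
    (f : {mpoly K[n]}) :
  (forall i, h i = 'X_(r i)) -> (msize (mmap (@mpolyC _ K) h f) <= msize f)%N.
Proof.
move=> hr; rewrite (@mmap_sum _ _ _ (fun i => U_(r i)%MM)) //.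
apply: leq_trans (mmeasure_sum _ _ _ _) _; apply/bigmax_leqP_seq => m mf _.
apply: leq_trans (msizeZ_le _ _) _; rewrite msizeX.
have -> : mdeg (expo (fun i => U_(r i)%MM) m) = mdeg m.
  rewrite !mdegE; under eq_bigr do rewrite mnmE.
  rewrite exchange_big; apply: eq_bigr => i _ /=.
  by rewrite -big_distrr /= -mdegE mdeg1 muln1.
exact: msize_mdeg_lt.
Qed.

End MonomialMaps.

(** * The toric ideal in terms of marginal counts *)

Section Marginals.

Definition var_at (V : finType) (G : sgraph V) (t : tvar G) : pred (word V) :=
  fun u => match t with
           | inl (e, (a, b)) => (u (val e).1 == a) && (u (val e).2 == b)
           | inr (l, a) => u (val l) == a
           end.

Definition word_expo (V : finType) (G : sgraph V) (u : word V) :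
    'X_{1..#|tvar G|} := [multinom (var_at (enum_val k) u : nat) | k < _].

Lemma phi_wordE (K : comNzRingType) (V : finType) (G : sgraph V) (u : word V) :
  phi_word K G u = 'X_[word_expo G u].
Proof.
rewrite mpolyXE_id.
under eq_bigr => k _ do rewrite mnmE -[in 'X_k](enum_valK k).
rewrite -(big_enum_val (A := tvar G)
  (fun t => 'X_(enum_rank t) ^+ var_at t u : tring K G)) /=.
rewrite big_sumType /=; congr (_ * _).
  rewrite (eq_bigr (fun p => 'X_(enum_rank (inl (p.1, p.2) : tvar G)) ^+
    var_at (inl (p.1, p.2)) u)) => [|[]] //.
  rewrite -(pair_bigA _ (fun e ab => 'X_(enum_rank (inl (e, ab) : tvar G)) ^+
    var_at (inl (e, ab)) u)) /=; apply: eq_bigr => e _.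
  rewrite (bigD1 (u (val e).1, u (val e).2)) //= !eqxx expr1 big1 ?mulr1 //.
  by move=> [a b]; rewrite xpair_eqE !(eq_sym (u _)) => /negbTE /= ->.
rewrite (eq_bigr (fun p => 'X_(enum_rank (inr (p.1, p.2) : tvar G)) ^+
  var_at (inr (p.1, p.2)) u)) => [|[]] //.
rewrite -(pair_bigA _ (fun l a => 'X_(enum_rank (inr (l, a) : tvar G)) ^+
  var_at (inr (l, a)) u)) /=; apply: eq_bigr => l _.
rewrite (bigD1 (u (val l))) //= eqxx expr1 big1 ?mulr1 //.
by move=> a; rewrite (eq_sym (u _)) => /negbTE ->.
Qed.

(** A monomial in the variables p_u is a multiset of words; this counts, with
    multiplicity, its words satisfying [P]. *)
Definition weight (V : finType) (m : 'X_{1..#|{ffun V -> bool}|})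
    (P : pred (word V)) : nat := (\sum_i m i * P (enum_val i))%N.

Lemma eq_weight (V : finType) m (P Q : pred (word V)) :
  P =1 Q -> weight m P = weight m Q.
Proof. by move=> PQ; apply: eq_bigr => i _; rewrite PQ. Qed.

Lemma weight_if (V : finType) m (P : pred (word V)) (c : bool) :
  weight m (fun u => c && P u) = if c then weight m P else 0%N.
Proof. by case: c => //; apply: big1 => i _; rewrite muln0. Qed.

Lemma weight_ifr (V : finType) m (P : pred (word V)) (c : bool) :
  weight m (fun u => P u && c) = if c then weight m P else 0%N.
Proof. by rewrite -weight_if; apply: eq_weight => u; rewrite andbC. Qed.

Lemma weight_split (V : finType) m (P : pred (word V)) (Q : word V -> bool) :
  (weight m (fun u => P u && Q u) + weight m (fun u => P u && ~~ Q u))%N =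
  weight m P.
Proof.
rewrite /weight -big_split; apply: eq_bigr => i _ /=; rewrite -mulnDr.
by case: (P _); case: (Q _).
Qed.

Definition same_marginals (V : finType) (G : sgraph V)
    (m m' : 'X_{1..#|{ffun V -> bool}|}) : Prop :=
  forall t : tvar G, weight m (var_at t) = weight m' (var_at t).

(** [edge G] keeps one orientation of each edge; the counts do not depend on
    this choice. *)
Lemma same_marginals_edge (V : finType) (G : sgraph V) m m' :
  same_marginals G m m' -> forall j k, adj G j k -> forall a b,
  weight m (fun u => (u j == a) && (u k == b)) =
  weight m' (fun u => (u j == a) && (u k == b)).
Proof.
move=> mm'; have lt_case j k a b : adj G j k -> (enum_rank j < enum_rank k)%N ->
    weight m (fun u => (u j == a) && (u k == b)) =
    weight m' (fun u => (u j == a) && (u k == b)).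
  move=> jk lt.
  have e : (enum_rank (j, k).1 < enum_rank (j, k).2)%N &&
           adj G (j, k).1 (j, k).2 by rewrite lt.
  exact: (mm' (inl (exist _ (j, k) e, (a, b)))).
move=> j k jk a b; have [lt|gt|eq] := ltngtP (enum_rank j) (enum_rank k).
- exact: lt_case.
- have := lt_case _ _ b a _ gt; rewrite adj_sym => /(_ jk) E.
  rewrite -(@eq_weight _ m _ _ (fun u => andbC _ _)).
  by rewrite -(@eq_weight _ m' _ _ (fun u => andbC _ _)).
by move: jk; rewrite (enum_rank_inj (val_inj eq)) adj_irr.
Qed.

(** At a vertex that is not isolated, sum the counts of an edge over the values
    at its other end. *)
Lemma same_marginals_vertex (V : finType) (G : sgraph V) m m' :
  same_marginals G m m' -> forall v a,
  weight m (fun u => u v == a) = weight m' (fun u => u v == a).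
Proof.
move=> mm' v a; case: (boolP [forall k, ~~ adj G v k]) => [isov|].
  exact: (mm' (inr (exist _ v isov, a))).
rewrite negb_forall => /existsP[k]; rewrite negbK => vk.
rewrite -(weight_split m _ (fun u => u k == true)).
rewrite -(weight_split m' _ (fun u => u k == true)).
rewrite (same_marginals_edge mm' vk); congr (_ + _)%N.
have E u : (u v == a) && ~~ (u k == true) = (u v == a) && (u k == false).
  by case: (u k).
by rewrite !(eq_weight _ E) (same_marginals_edge mm' vk).
Qed.

(** The vertex [v] matters: over the empty graph nothing is recorded, and I_G
    is generated by the inhomogeneous p - 1. *)
Lemma same_marginals_total (V : finType) (G : sgraph V) m m' (v : V) :
  same_marginals G m m' -> weight m predT = weight m' predT.
Proof.
move=> mm'; rewrite -(weight_split m _ (fun u : word V => u v == true)).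
rewrite -(weight_split m' _ (fun u : word V => u v == true)) /=.
rewrite (same_marginals_vertex mm'); congr (_ + _)%N.
have E u : ~~ (u v == true) = (u v == false) by case: (u v).
by rewrite !(eq_weight _ E) (same_marginals_vertex mm').
Qed.

Lemma expo_weight (V W : finType) (G : sgraph W) (sg : word V -> word W) m t :
  expo (fun i => word_expo G (sg (enum_val i))) m (enum_rank t) =
  weight m (fun u => var_at t (sg u)).
Proof. by rewrite mnmE; apply: eq_bigr => i _; rewrite mnmE enum_rankK. Qed.

Lemma expo_eqP (V W : finType) (G : sgraph W) (sg : word V -> word W) m m' :
  expo (fun i => word_expo G (sg (enum_val i))) m =
  expo (fun i => word_expo G (sg (enum_val i))) m' <->
  forall t : tvar G, weight m (fun u => var_at t (sg u)) =
                     weight m' (fun u => var_at t (sg u)).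
Proof.
split=> [E t|E]; first by rewrite -!expo_weight E.
by apply/mnmP=> j; rewrite -(enum_valK j) !expo_weight.
Qed.

End Marginals.

Section Tables.
Variable (d : nat) (V : finType).

Definition table_expo (I : table d V) : 'X_{1..#|{ffun V -> bool}|} :=
  (\sum_(j < d) U_(enum_rank (I j)))%MM.

Lemma table_expoE (K : comNzRingType) (I : table d V) :
  \prod_(j < d) pvar K (I j) = 'X_[table_expo I].
Proof. by rewrite /table_expo (big_morph _ (@mpolyXD _ K) (@mpolyX0 _ K)). Qed.

Lemma weight_table (I : table d V) (P : pred (word V)) :
  weight (table_expo I) P = #|[set j | P (I j)]|.
Proof.
rewrite /weight; under eq_bigr do rewrite mnm_sumE big_distrl.
rewrite exchange_big -sum1dep_card [RHS]big_mkcond.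
apply: eq_bigr => j _ /=.
rewrite (bigD1 (enum_rank (I j))) //= mnm1E eqxx mul1n enum_rankK.
rewrite big1 ?addn0 => [|i]; first by case: (P _).
by rewrite mnm1E eq_sym => /negbTE ->.
Qed.

Lemma toric_binomP (K : comNzRingType) (G : sgraph V) (I J : table d V) :
  toric_ideal G (binom_of K I J) <->
  same_marginals G (table_expo I) (table_expo J).
Proof.
rewrite /toric_ideal /binom_of !table_expoE /phi_hom raddfB /=.
pose a (i : 'I_#|{ffun V -> bool}|) := word_expo G (enum_val i).
have hE i : phi_word K G (enum_val i) = 'X_[a i].
  exact: phi_wordE.
rewrite !(mmap_monomial _ hE); split=> [/eqP|E]; last first.
  by apply/eqP; rewrite subr_eq0; apply/eqP; congr 'X_[_]; apply/(expo_eqP _ id).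
rewrite subr_eq0 => /eqP /(congr1 (mcoeff (expo a (table_expo I)))).
rewrite !mcoeffX eqxx; case: eqP => [/(expo_eqP _ id) E _|_ /eqP].
  by move=> t; rewrite E.
by rewrite oner_eq0.
Qed.

End Tables.

(** * Substitutions of words *)

Section Substitution.
Variable K : comNzRingType.

Definition subst (V W : finType) (sg : word V -> word W) :
    pring K V -> pring K W :=
  mmap (@mpolyC _ K) (fun i => pvar K (sg (enum_val i))).

Lemma subst_binom d (V W : finType) (sg : word V -> word W) (I J : table d V) :
  subst sg (binom_of K I J) = binom_of K (sg \o I) (sg \o J).
Proof.
have prodE (T : table d V) :
    subst sg (\prod_(j < d) pvar K (T j)) = \prod_(j < d) pvar K (sg (T j)).
  rewrite /subst rmorph_prod; apply: eq_bigr => j _.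
  by rewrite [LHS]mmapX mmap1U enum_rankK.
by rewrite /binom_of /subst raddfB /= -!/(subst _ _) !prodE.
Qed.

Lemma eq_binom d (V : finType) (I J I' J' : table d V) :
  I =1 I' -> J =1 J' -> binom_of K I J = binom_of K I' J'.
Proof.
by move=> EI EJ; congr (_ - _); apply: eq_bigr => j _; rewrite ?EI ?EJ.
Qed.

Lemma msize_subst (V W : finType) (sg : word V -> word W) f :
  (msize (subst sg f) <= msize f)%N.
Proof. exact: msize_mmap_var. Qed.

Lemma ideal_generated_subst (V W : finType) (sg : word V -> word W)
    (S : pring K V -> Prop) (S' : pring K W -> Prop) f :
  (forall g, S g -> S' (subst sg g)) ->
  ideal_generated S f -> ideal_generated S' (subst sg f).
Proof.
move=> SS' [s [sS ->]]; exists [seq (subst sg x.1, subst sg x.2) | x <- s].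
split=> [_ /mapP[x /sS Sx ->]|]; first exact: SS'.
rewrite big_map /subst rmorph_sum; apply: eq_bigr => x _ /=.
by rewrite rmorphM.
Qed.

(** The column of [w] is copied from that of [F w], or is constantly [false] if
    there is none, and is then complemented if [s w] holds.  With a suitable
    [s] this covers the constants at deleted vertices as well as the action of
    (Z/2)^n. *)
Definition pull_word (V W : finType) (F : W -> option V) (s : word W)
    (u : word V) : word W :=
  [ffun w => (if F w is Some x then u x else false) (+) s w].

(** A pair of adjacent columns of G is read off from one edge, one vertex or no
    vertex of R, so the marginals over R determine those over G.  When there is
    no vertex the total degree is needed, which is why R must have a vertex. *)
Lemma toric_pull (V W : finType) (R : sgraph V) (G : sgraph W)
    (F : W -> option V) (s : word W) (v0 : V) (f : pring K V) :
  (forall j k x y, adj G j k -> F j = Some x -> F k = Some y ->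
     x = y \/ adj R x y) ->
  toric_ideal R f -> toric_ideal G (subst (pull_word F s) f).
Proof.
move=> FG; rewrite /toric_ideal /phi_hom /subst mmap_comp_monomial.
apply: (@monomial_kernel_sub _ _ _ _ _ _ (fun i => word_expo R (enum_val i))
  (fun i => word_expo G (pull_word F s (enum_val i)))) => [i|i|m m'].
- exact: phi_wordE.
- by rewrite mmapX mmap1U enum_rankK phi_wordE.
move=> /(expo_eqP _ id) mm'; have {}mm' : same_marginals R m m' by [].
apply/expo_eqP.
have pullE w a u : (pull_word F s u w == a) =
    if F w is Some x then u x == a (+) s w else a == s w.
  rewrite ffunE; case: (F w) => [x|]; last by case: (s w); case: a.
  by case: (u x); case: (s w); case: a.
case=> [[[[j k] /= jk] [a b]]|[[l isol] a]] /=; last first.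
  (* An isolated vertex of G may still copy a vertex of R with neighbours. *)
  rewrite !(eq_weight _ (pullE l a)); case: (F l) => [x|].
    exact: same_marginals_vertex mm' _ _.
  transitivity (weight m (fun u => (a == s l) && predT u)).
    by apply: eq_weight => u; rewrite andbT.
  transitivity (weight m' (fun u => (a == s l) && predT u)).
    by rewrite !weight_if (same_marginals_total v0 mm').
  by apply: eq_weight => u; rewrite andbT.
have /andP[_ {}jk] := jk.
have E u : (pull_word F s u j == a) && (pull_word F s u k == b) =
    (if F j is Some x then u x == a (+) s j else a == s j) &&
    (if F k is Some x then u x == b (+) s k else b == s k).
  by rewrite !pullE.
rewrite !(eq_weight _ E) {E}.
case Fj: (F j) => [x|]; case Fk: (F k) => [y|].
- have [<-|xy] := FG _ _ _ _ jk Fj Fk; last first.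
    exact: same_marginals_edge mm' _ _ xy _ _.
  have E u : (u x == a (+) s j) && (u x == b (+) s k) =
      (a (+) s j == b (+) s k) && (u x == a (+) s j).
    by case: (u x); case: (a (+) s j); case: (b (+) s k).
  by rewrite !(eq_weight _ E) !weight_if (same_marginals_vertex mm').
- by rewrite !weight_ifr (same_marginals_vertex mm').
- by rewrite !weight_if (same_marginals_vertex mm').
transitivity (weight m (fun u => ((a == s j) && (b == s k)) && predT u)).
  by apply: eq_weight => u; rewrite andbT.
transitivity (weight m' (fun u => ((a == s j) && (b == s k)) && predT u)).
  by rewrite !weight_if (same_marginals_total v0 mm').
by apply: eq_weight => u; rewrite andbT.
Qed.

End Substitution.

(** * Minors *)

Section MinorLemmas.
Variables (V : finType) (G : sgraph V).

Lemma minor_surj (W : finType) (H : sgraph W) f :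
  minor G H f -> forall h, exists v, f v = Some h.
Proof.
elim=> {W H f} [h|W H f w _ IH h|W H f a b ab _ IH h].
- by exists h.
- have [v fv] := IH (val h); exists v.
  by rewrite fv /= /delete_vertex valK.
have [v fv] := IH (val h); exists v; rewrite fv /= /contract_vertex.
by congr Some; apply: val_inj; rewrite val_insubd (valP h).
Qed.

Lemma minor_adj (W : finType) (H : sgraph W) f :
  minor G H f -> forall j k x y, adj G j k -> f j = Some x -> f k = Some y ->
  x = y \/ adj H x y.
Proof.
elim=> {W H f} [j k x y jk [<-] [<-]|W H f w _ IH j k x y jk|
  W H f a b ab _ IH j k x y jk]; first by right.
- case fj: (f j) => [h|//] /=; case fk: (f k) => [h'|//] /=.
  rewrite /delete_vertex; case: insubP => // x' _ xE [<-].
  case: insubP => // y' _ yE [<-].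
  by have [E|E] := IH _ _ _ _ jk fj fk; [left; apply: val_inj; rewrite xE E|
    right; rewrite /= xE yE].
case fj: (f j) => [h|//] /= [<-]; case fk: (f k) => [h'|//] /= [<-].
have [->|hh'] := IH _ _ _ _ jk fj fk; first by left.
have [->|ne] := eqVneq (contract_vertex ab h) (contract_vertex ab h').
  by left.
right; apply/andP; split=> //.
by apply/existsP; exists h; apply/existsP; exists h'; rewrite hh' !eqxx.
Qed.

(** Given a partial labelling by vertices of Y in which adjacent vertices have
    equal or adjacent labels, delete unlabelled vertices and contract edges
    with equal labels as long as there are any.  The labels descend along each
    step, the number of vertices drops, and when no step remains the labelling
    is a homomorphism to Y. *)
Lemma minor_of_labels (X : finType) (Y : sgraph X) (lab : V -> option X) :
  (forall j k x y, adj G j k -> lab j = Some x -> lab k = Some y ->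
     x = y \/ adj Y x y) ->
  exists (W : finType) (H : sgraph W) (f : V -> option W) (phi : ghom H Y),
    minor G H f /\ forall v, lab v = omap phi (f v).
Proof.
move=> labG.
suff: forall N (W : finType) (H : sgraph W) f (l : W -> option X),
    (#|W| < N)%N -> minor G H f -> (forall v, lab v = obind l (f v)) ->
    (forall j k x y, adj H j k -> l j = Some x -> l k = Some y ->
       x = y \/ adj Y x y) ->
    exists (W : finType) (H : sgraph W) (f : V -> option W) (phi : ghom H Y),
      minor G H f /\ forall v, lab v = omap phi (f v).
  by move/(_ #|V|.+1 V G Some lab (leqnn _) (MinorRefl G) (fun v => erefl) labG).
elim=> // N IH W H f l WN mH labf lH.
have cardD (w : W) : (#|{: {x : W | x != w}}| < N)%N.
  rewrite card_sig (@eq_card _ _ (predC1 w)) // cardC1.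
  have : (0 < #|W|)%N by apply/card_gt0P; exists w.
  by case: #|W| WN.
case: (pickP (fun w => ~~ isSome (l w))) => [w lw|lS].
  apply: (IH _ _ _ (l \o val) (cardD w) (MinorDelete w mH)) => [v|j k x y].
    rewrite labf; case: (f v) => //= h; rewrite /delete_vertex.
    case: insubP => /= [u _ ->//|]; rewrite negbK => /eqP ->.
    by case: (l w) lw.
  exact: lH.
case: (pickP (fun ab => adj H ab.1 ab.2 && (l ab.1 == l ab.2))) =>
  [[a b] /= /andP[ab /eqP lab_ab]|Hdiff].
  have lc h : l (val (contract_vertex ab h)) = l h.
    rewrite val_insubd; case: eqVneq => [->|_] //=.
  apply: (IH _ _ _ (l \o val) (cardD b) (MinorContract ab mH)) => [v|j k x y].
    by rewrite labf; case: (f v) => //= h; rewrite lc.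
  move=> /andP[_ /existsP[u /existsP[v /and3P[uv /eqP <- /eqP <-]]]] /=.
  by rewrite !lc; apply: lH uv.
have getP w : {x | l w = Some x}.
  by move: (lS w); case: (l w) => // x _; exists x.
have phiP x y : adj H x y -> adj Y (sval (getP x)) (sval (getP y)).
  move=> xy; case: (getP x) (getP y) => x' lx [y' ly] /=.
  have [E|//] := lH _ _ _ _ xy lx ly.
  by have := Hdiff (x, y); rewrite /= xy lx ly E eqxx.
exists W, H, f, (GHom phiP); split=> // v.
by rewrite labf; case: (f v) => //= h; case: (getP h).
Qed.

End MinorLemmas.

(** * Pullbacks of the distinguished generator *)

Section Assembly.

(** Each of the four regions cut out by two sets has a cardinality determined
    by those of the sets and of their intersection. *)
Lemma card_pair d (S1 S2 T1 T2 : {set 'I_d}) (a b : bool) :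
  #|S1| = #|T1| -> #|S2| = #|T2| -> #|S1 :&: S2| = #|T1 :&: T2| ->
  #|[set j | ((j \in S1) == a) && ((j \in S2) == b)]| =
  #|[set j | ((j \in T1) == a) && ((j \in T2) == b)]|.
Proof.
move=> E1 E2 E12.
have cardE (A B : {set 'I_d}) : #|[set j | ((j \in A) == a) && ((j \in B) == b)]| =
    match a, b with
    | true, true => #|A :&: B| | true, false => (#|A| - #|A :&: B|)%N
    | false, true => (#|B| - #|A :&: B|)%N
    | false, false => (d - (#|A| + #|B| - #|A :&: B|))%N
    end.
  case: a; case: b.
  - by apply: eq_card => j; rewrite !inE !eqb_id.
  - rewrite -cardsD; apply: eq_card => j.
    by rewrite !inE; case: (j \in A); case: (j \in B).
  - rewrite setIC -cardsD; apply: eq_card => j.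
    by rewrite !inE; case: (j \in A); case: (j \in B).
  rewrite -cardsU -[X in (X - _)%N]card_ord -(setCK (A :|: B)) -cardsCs.
  by apply: eq_card => j; rewrite !inE; case: (j \in A); case: (j \in B).
by rewrite !cardE E1 E2 E12.
Qed.

Lemma card_mem_eq d (S T : {set 'I_d}) (a : bool) :
  #|S| = #|T| -> #|[set j | (j \in S) == a]| = #|[set j | (j \in T) == a]|.
Proof.
have cardE (A : {set 'I_d}) :
    #|[set j | (j \in A) == a]| = (if a then #|A| else d - #|A|)%N.
  case: a.
    by apply: eq_card => j; rewrite !inE eqb_id.
  rewrite -[X in (X - _)%N]card_ord -{2}(setCK A) -cardsCs.
  by apply: eq_card => j; rewrite !inE; case: (j \in A).
by rewrite !cardE => ->.
Qed.

(** The edges of the image are edges of X_d, and adjacency in X_d is equality of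
    the counts of rows (1, 1); the other counts follow from |S| = |T|. *)
Lemma toric_restricted (K : comNzRingType) d (W : finType) (H : sgraph W)
    (phi : ghom H (fund_graph d)) :
  toric_ideal (im_graph phi) (restricted_gen phi K).
Proof.
have cardST (x : fund_vertex d) : #|(val x).1| = #|(val x).2|.
  by have /and5P[_ _ /eqP] := valP x.
apply/toric_binomP=> -[[[[x y] /= xy] [a b]]|[[x isox] a]] /=;
  rewrite !weight_table.
  have E (T : table d (fund_vertex d)) (st : fund_vertex d -> {set 'I_d}) :
      (forall j z, T j z = (j \in st z)) ->
      #|[set j | (restrict_table (fun z => z \in codom phi) T j x == a) &&
                 (restrict_table (fun z => z \in codom phi) T j y == b)]| =
      #|[set j | ((j \in st (val x)) == a) && ((j \in st (val y)) == b)]|.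
    by move=> TE; apply: eq_card => j; rewrite !inE !ffunE !TE.
  rewrite (E _ (fun z => (val z).1)) => [|j z]; last by rewrite ffunE.
  rewrite (E _ (fun z => (val z).2)) => [|j z]; last by rewrite ffunE.
  apply: card_pair; rewrite ?cardST //.
  have /andP[_ /existsP[u /existsP[v /and3P[uv /eqP <- /eqP <-]]]] := xy.
  by have /andP[_ /eqP] := ghom_adj phi uv.
have E (T : table d (fund_vertex d)) (st : fund_vertex d -> {set 'I_d}) :
    (forall j z, T j z = (j \in st z)) ->
    #|[set j | restrict_table (fun z => z \in codom phi) T j x == a]| =
    #|[set j | (j \in st (val x)) == a]|.
  by move=> TE; apply: eq_card => j; rewrite !inE !ffunE !TE.
rewrite (E _ (fun z => (val z).1)) => [|j z]; last by rewrite ffunE.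
rewrite (E _ (fun z => (val z).2)) => [|j z]; last by rewrite ffunE.
exact: card_mem_eq.
Qed.

(** Makes [toric_pull] and [ideal_generated_subst] applicable to flipped
    pullbacks: the flip and the deletion constants are absorbed into a single
    substitution. *)
Lemma flip_pullback_subst (K : comNzRingType) d (V W : finType) (H : sgraph W)
    (phi : ghom H (fund_graph d)) (f : V -> option W) (c : V -> bool) (s : word V) :
  flip s (pullback phi K f c) =
  subst (pull_word (fun v => omap (to_im phi) (f v))
     [ffun v => (if f v then s v else c v (+) s v)]) (restricted_gen phi K).
Proof.
rewrite [LHS](@subst_binom K d V V (flip_word s)) subst_binom.
by apply: eq_binom => j; apply/ffunP=> v; rewrite /= !ffunE /=;
  case: (f v) => //=; rewrite ?ffunE // addbA.
Qed.

Lemma pullback_subst (K : comNzRingType) d (V W : finType) (H : sgraph W)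
    (phi : ghom H (fund_graph d)) (f : V -> option W) (c : V -> bool) :
  pullback phi K f c =
  subst (pull_word (fun v => omap (to_im phi) (f v))
     [ffun v => (if f v then false else c v)]) (restricted_gen phi K).
Proof.
rewrite subst_binom.
by apply: eq_binom => j; apply/ffunP=> v; rewrite /= !ffunE /=;
  case: (f v) => //= h; rewrite addbF.
Qed.

Lemma minor_im_adj (V W X : finType) (G : sgraph V) (H : sgraph W) (Y : sgraph X)
    (phi : ghom H Y) f :
  minor G H f -> forall j k x y, adj G j k ->
  omap (to_im phi) (f j) = Some x -> omap (to_im phi) (f k) = Some y ->
  x = y \/ adj (im_graph phi) x y.
Proof.
move=> mH j k x y jk; case fj: (f j) => [h|//] [<-]; case fk: (f k) => [h'|//] [<-].
have [->|hh'] := minor_adj mH jk fj fk; [by left | right].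
by apply/existsP; exists h; apply/existsP; exists h'; rewrite hh' !eqxx.
Qed.

(** Over the empty vertex set there is a single word, so all tables agree. *)
Lemma binom_nonempty (K : comNzRingType) d (V : finType) (I J : table d V) :
  binom_of K I J != 0 -> inhabited V.
Proof.
move=> nz; case: (pickP (xpredT : pred V)) => [v _|V0]; first by [].
case/negP: nz; rewrite /binom_of subr_eq0; apply/eqP; apply: eq_bigr => j _.
by congr pvar; apply/ffunP=> v; have := V0 v.
Qed.

Lemma pullback_in_ideal (K : comNzRingType) d (V W : finType) (G : sgraph V)
    (H : sgraph W) (phi : ghom H (fund_graph d)) (f : V -> option W)
    (c : V -> bool) :
  minor G H f -> is_binomial d (restricted_gen phi K) ->
  is_binomial d (pullback phi K f c) /\ toric_ideal G (pullback phi K f c).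
Proof.
move=> mH [nz _]; rewrite /is_binomial; split; last first.
  have [v0] := binom_nonempty nz.
  rewrite pullback_subst; apply: (toric_pull _ v0 (minor_im_adj mH)).
  exact: toric_restricted.
split; last by eexists; eexists; reflexivity.
apply: contra nz => /eqP p0.
(* [back] reads the column of a vertex of R at a vertex of G lying over it. *)
have lift (x : im_vertex phi) : {v | omap (to_im phi) (f v) = Some x}.
  have : exists v, omap (to_im phi) (f v) == Some x.
    have /codomP[h xh] := valP x; have [v fv] := minor_surj mH h.
    by exists v; rewrite fv /=; apply/eqP; congr Some; apply: val_inj.
  by move=> ex; exists (xchoose ex); apply/eqP/(xchooseP ex).
pose back (u : word V) : word (im_vertex phi) := [ffun x => u (sval (lift x))].
have : subst back (pullback phi K f c) = 0 by rewrite p0 /subst raddf0.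
rewrite pullback_subst !subst_binom => E; apply/eqP; rewrite -[RHS]E.
apply: eq_binom => j; apply/ffunP=> x; rewrite /= !ffunE;
  case: (lift x) => v /=; case: (f v) => //= h [<-]; by rewrite addbF ?ffunE.
Qed.

(** The contrapositive: substitution turns an expression of the restricted
    generator through elements of lower degree into one of its pullback. *)
Lemma restricted_minimal (K : comNzRingType) d (V W : finType) (G : sgraph V)
    (H : sgraph W) (phi : ghom H (fund_graph d)) (f : V -> option W)
    (c : V -> bool) (s : word V) :
  minor G H f -> is_min_generator G d (flip s (pullback phi K f c)) ->
  is_min_generator (im_graph phi) d (restricted_gen phi K).
Proof.
rewrite flip_pullback_subst => mH [[nz _] _ notlow].
have nzR : restricted_gen phi K != 0.
  by apply: contra nz => /eqP ->; rewrite /subst raddf0.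
have [v0] := binom_nonempty nzR.
split; first by split=> //; eexists; eexists; reflexivity.
  exact: toric_restricted.
move=> low; apply: notlow; apply: ideal_generated_subst low => g [gR gd].
split; last by apply: leq_trans (msize_subst _ _) gd.
exact: (toric_pull _ v0 (minor_im_adj mH)).
Qed.

(** Applied to the two tables, this gives the sets S and T of the vertex [v]
    after the flip by [s]. *)
Definition column_set d (V : finType) (I : table d V) (s : word V) (v : V) :
    {set 'I_d} := [set j | I j v (+) s v].

(** Of a set and its complement, at least one has at most d/2 elements, and if
    both have d/2 then exactly one contains the first row. *)
Lemma normalizing_flip d (V : finType) (I : table d V) (j0 : 'I_d) :
  val j0 = 0%N ->
  exists s : word V, forall v, let S := column_set I s v in
    (2 * #|S| <= d)%N && ((2 * #|S| == d)%N ==> [exists j in S, val j == 0%N]).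
Proof.
move=> j00.
pose C v := [set j | I j v].
exists [ffun v => (d < 2 * #|C v|)%N || ((2 * #|C v| == d)%N && ~~ I j0 v)] => v /=.
set s := finfun _.
have -> : column_set I s v = if s v then ~: C v else C v.
  by apply/setP=> j; rewrite !inE; case: (s v); rewrite !inE ?addbT ?addbF.
have := cardsC (C v); rewrite card_ord => cC.
have ex (S : {set 'I_d}) : j0 \in S -> [exists j in S, val j == 0%N].
  by move=> j0S; apply/existsP; exists j0; rewrite j0S j00 eqxx.
rewrite ffunE; case: ifP => [/orP[lt|/andP[/eqP eq nI]]|/norP[ge /nandP ne]].
- move: cC lt; move: #|C v| #|~: C v| => a b; move=> {s ex} cC lt.
  by apply/andP; split; [lia | apply/implyP=> /eqP; lia].
- apply/andP; split; last by apply/implyP=> _; apply: ex; rewrite !inE.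
  by move: cC eq; move: #|C v| #|~: C v| => a b; lia.
apply/andP; split; first by rewrite leqNgt.
apply/implyP=> eq; apply: ex; rewrite inE.
by case: ne => [|/negPn //]; rewrite eq.
Qed.

Lemma column_inter_card d (V : finType) (G : sgraph V) (I J : table d V) s j k :
  same_marginals G (table_expo I) (table_expo J) -> adj G j k ->
  #|column_set I s j :&: column_set I s k| =
  #|column_set J s j :&: column_set J s k|.
Proof.
move=> IJ jk.
have E (T : table d V) : #|column_set T s j :&: column_set T s k| =
    weight (table_expo T) (fun u => (u j == ~~ s j) && (u k == ~~ s k)).
  rewrite weight_table; apply: eq_card => i; rewrite !inE -!negb_add !addbN.
  by rewrite !negbK.
by rewrite !E (same_marginals_edge IJ jk).
Qed.

Lemma column_card d (V : finType) (G : sgraph V) (I J : table d V) s v :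
  same_marginals G (table_expo I) (table_expo J) ->
  #|column_set I s v| = #|column_set J s v|.
Proof.
move=> IJ.
have E (T : table d V) : #|column_set T s v| =
    weight (table_expo T) (fun u => u v == ~~ s v).
  rewrite weight_table; apply: eq_card => i; rewrite !inE -!negb_add !addbN.
  by rewrite !negbK.
by rewrite !E (same_marginals_vertex IJ).
Qed.

(** Label each column by its pair of sets.  After the normalizing flip this pair
    fails to be a vertex of X_d only when it is empty, and such columns take the
    constant 0. *)
Lemma toric_binom_pullback (K : comNzRingType) d (V : finType) (G : sgraph V)
    (I J : table d V) :
  (0 < d)%N -> toric_ideal G (binom_of K I J) ->
  exists (W : finType) (H : sgraph W) (f : V -> option W)
         (phi : ghom H (fund_graph d)) (s : word V),
    minor G H f /\ binom_of K I J = flip s (pullback phi K f (fun=> false)).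
Proof.
move=> d0 /toric_binomP IJ.
have [s sP] := normalizing_flip I (erefl : val (Ordinal d0) = 0%N).
pose st v := (column_set I s v, column_set J s v).
pose lab v : option (fund_vertex d) := insub (st v).
have labP v x : lab v = Some x -> val x = st v.
  by rewrite /lab; case: insubP => // x' _ <- [<-].
have [|W [H [f [phi [mH labf]]]]] := @minor_of_labels _ G _ (fund_graph d) lab.
  move=> j k x y jk /labP xE /labP yE.
  have [->|ne] := eqVneq x y; [by left | right].
  apply/andP; split=> //.
  by rewrite xE yE; apply/eqP; exact: column_inter_card IJ jk.
exists W, H, f, phi, s; split=> //.
rewrite [RHS](@subst_binom K d V V (flip_word s)).
have labN v : lab v = None -> st v = (set0, set0).
  rewrite /lab; case: insubP => // nP _.
  have S0 : column_set I s v = set0.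
    apply: contraNeq nP => nz; have /andP[h1 h2] := sP v.
    apply/and5P; split=> //=; last by rewrite (column_card _ _ IJ).
    by rewrite -card_gt0 -(column_card _ _ IJ) card_gt0.
  rewrite /st S0; congr (_, _); apply/eqP.
  by rewrite -cards_eq0 -(column_card _ _ IJ) S0 cards0.
apply: eq_binom => j; apply/ffunP=> v; rewrite /= !ffunE.
  case fv: (f v) (labf v) => [h|] /= => [/labP stE|/labN [S0 _]].
    by rewrite !ffunE /= stE inE -addbA addbb addbF.
  by have := in_set0 j; rewrite -S0 inE => /(canRL (addbK _)).
case fv: (f v) (labf v) => [h|] /= => [/labP stE|/labN [_ T0]].
  by rewrite !ffunE /= stE inE -addbA addbb addbF.
by have := in_set0 j; rewrite -T0 inE => /(canRL (addbK _)).
Qed.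

End Assembly.

Theorem theorem4p8 (R : realType) (n : nat) (G : sgraph 'I_n) (d : nat)
    (hd : (2 <= d)%N) :
  (forall (W : finType) (H : sgraph W) (f : 'I_n -> option W)
          (phi : ghom H (fund_graph d)) (c : 'I_n -> bool),
      minor G H f ->
      is_min_generator (im_graph phi) d (restricted_gen phi R[i]) ->
      is_binomial d (pullback phi R[i] f c) /\
      toric_ideal G (pullback phi R[i] f c))
  /\
  (forall g : pring R[i] 'I_n,
      is_min_generator G d g ->
      exists (W : finType) (H : sgraph W) (f : 'I_n -> option W)
             (phi : ghom H (fund_graph d)) (c : 'I_n -> bool)
             (s : word 'I_n),
        [/\ minor G H f,
            is_min_generator (im_graph phi) d (restricted_gen phi R[i])
          & g = flip s (pullback phi R[i] f c)]).
Proof.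
split=> [W H f phi c mH [bin _ _]|g gmin]; first exact: pullback_in_ideal.
have [[_ [I [J gE]]] gG _] := gmin.
rewrite gE in gmin gG *.
have [W [H [f [phi [s [mH E]]]]]] := toric_binom_pullback (ltnW hd) gG.
exists W, H, f, phi, (fun=> false), s; split=> //.
by apply: (restricted_minimal (c := fun=> false) (s := s) mH); rewrite -E.
Qed.
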